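(* Let $A$ be an arrow presentation and $\{H^{(f)}\}_{f\in E(A)}$ a family of arrow presentations indexed by the edges of $A$, all with pairwise disjoint edge sets; for each edge $f$ of $A$ let $\varphi_f$ be a coupling of $f$ with an edge $e^{(f)}$ of $H^{(f)}$, and $\boldsymbol\varphi=\{\varphi_f\}$. Let $(\mathbf a,\mathbf b,\mathbf c)=\{(a_g,b_g,c_g)\}$ be indeterminate triples indexed by all edges involved and $t$ an indeterminate. For each $f\in E(A)$ let $\phi^{(f)}_{\parallel},\phi^{(f)}_{=},\phi^{(f)}_{\times}$ be the unique solution of \[\begin{bmatrix}t^2&t&t\\t&t^2&t\\t&t&t^2\end{bmatrix}\begin{bmatrix}\phi^{(f)}_{\parallel}\\\phi^{(f)}_{=}\\\phi^{(f)}_{\times}\end{bmatrix}=\begin{bmatrix}\tilde{\mathbf Q}(H^{(f)}/e^{(f)};(\mathbf a,\mathbf b,\mathbf c),t)\\\tilde{\mathbf Q}(H^{(f)}\setminus e^{(f)};(\mathbf a,\mathbf b,\mathbf c),t)\\\tilde{\mathbf Q}(H^{(f)}\dagger e^{(f)};(\mathbf a,\mathbf b,\mathbf c),t)\end{bmatrix}.\] Then \[\tilde{\mathbf Q}(A\otimes_{\boldsymbol\varphi}\{H^{(f)}\}_{f\in E(A)};(\mathbf a,\mathbf b,\mathbf c),t)=\tilde{\mathbf Q}(A;(\boldsymbol\phi_{\parallel},\boldsymbol\phi_{=},\boldsymbol\phi_{\times}),t),\] where $(\boldsymbol\phi_{\parallel},\boldsymbol\phi_{=},\boldsymbol\phi_{\times})$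 assigns to each $f\in E(A)$ the triple $(\phi^{(f)}_{\parallel},\phi^{(f)}_{=},\phi^{(f)}_{\times})$ (so $\phi^{(f)}_{\parallel}$ plays the role of $a_f$, $\phi^{(f)}_{=}$ of $b_f$, and $\phi^{(f)}_{\times}$ of $c_f$).
   Context: An arrow presentation $A$ consists of a finite set $V(A)$ of disjoint circles (the vertices), a finite set of pairwise disjoint arrows (directed arcs) on the circles, and a finite set $E(A)$ of labels (the edges) such that every arrow carries one label and every label is carried by exactly two arrows (constituting that edge). An arrow along a circle from $p$ to $q$ is written $\overrightarrow{pq}$. Arrow presentations are considered up to equivalence (diffeomorphism of circles sending arrows to arrows, reversing both arrows of some edges, relabelling edges bijectively). For an edge $e$ with arrows $\overrightarrow{p_1p_2},\overrightarrow{q_1q_2}$: the deletion $A\setminus e$ removes the two arrows (not their arcs) and $e$; the contraction $A/e$ removes the arrows with the interiors of their arcs, identifies $p_1$ with $q_2$ and $p_2$ with $q_1$, and removes $e$; the Penrose-contraction $A\dagger e$ does the same but identifies $p_1$ with $q_1$ and $p_2$ with $q_2$. A coupling of an edge $f$ of $A$ and an edge $e$ of $A'$ is a bijection $\varphi$ from the two arrows constituting $f$ to the two arrows constituting $e$. If $\varphi$ sends $\overrightarrow{p_1p_2}$ to $\overrightarrow{q_1q_2}$ and $\overrightarrow{p_3p_4}$ to $\overrightarrow{q_3q_4}$, the 2-sum $A\oplus_\varphi A'$ is obtained from the disjoint union by deleting these four arrows together with the interiors of the arcs they lie on and identifying $p_i$ with $q_i$ for $i=1,\dots,4$. The tensor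 product $A\otimes_{\boldsymbol\varphi}\{H^{(f)}\}_{f\in E(A)}$ is obtained from $A$ by taking, for every edge $f$ of $A$, the 2-sum with $H^{(f)}$ with respect to $\varphi_f$ (the result does not depend on the order). The topological transition polynomial $\tilde{\mathbf Q}(A;(\mathbf a,\mathbf b,\mathbf c),t)$ of an arrow presentation with a triple $(a_e,b_e,c_e)$ of indeterminates for each edge is the unique map satisfying $\tilde{\mathbf Q}(A)=a_e\tilde{\mathbf Q}(A/e)+b_e\tilde{\mathbf Q}(A\setminus e)+c_e\tilde{\mathbf Q}(A\dagger e)$ for any edge $e$, and $\tilde{\mathbf Q}(A)=t^{p}$ if $A$ has no edges and $p$ vertices. *)

(* Defs.v *)
From HB Require Import structures.
From mathcomp Require Import all_boot all_order all_algebra all_fingroup.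
From mathcomp Require Import ring mpoly.

Set Implicit Arguments.
Unset Strict Implicit.
Unset Printing Implicit Defensive.

Import GRing.Theory.

Local Open Scope ring_scope.

(* Encoding of arrow presentations with edges labelled in a finite set L.
   The two arrows of the edge e are called (e, false) and (e, true); the arrow
   (e, i) points from (e, i, false) to (e, i, true).  A circle carrying n >= 1
   arrows is cut by its 2n arrow ends into the n arcs of the arrows and n
   complementary segments; [seg] sends an arrow end to the other end of the
   complementary segment starting there.  Up to diffeomorphism the circles with
   arrows are determined by [seg]; [bare] counts the circles without arrows.
   An edge label is an element of L, so deleting or contracting e leaves the
   other labels unchanged. *)

Definition arrow_end (L : finType) : finType := (L * bool * bool)%type.

Definition arrow_tail (L : finType) (e : L) (i : bool) : arrow_end L := (e, i, false).
Definition arrow_head (L : finType) (e : L) (i : bool) : arrow_end L := (e, i, true).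

Record presentation (L : finType) := Presentation {
  edges : {set L};
  seg : {ffun arrow_end L -> arrow_end L};
  bare : nat
}.

(* [seg] is the identity on the arrow ends of the unused labels and a
   fixed-point-free involution of the arrow ends of the edges. *)
Definition arrow_presentation (L : finType) (A : presentation L) : Prop :=
  involutive (seg A) /\
  forall x : arrow_end L, (seg A x != x) = (x.1.1 \in edges A).

Definition opposite_end (L : finType) (x : arrow_end L) : arrow_end L :=
  (x.1, ~~ x.2).

(* The circles carrying arrows are the components of the 2-regular multigraph
   whose edges are the arcs of the arrows and the complementary segments. *)
Definition num_vertices (L : finType) (A : presentation L) : nat :=
  (bare A +
   n_comp [rel x y | (y == opposite_end x) || (y == seg A x)]
          [set x : arrow_end L | x.1.1 \in edges A])%N.

(* Once the arrows (or the arcs) next to the distinct points p and q have been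
   removed, identify p and q.  If p and q are the two ends of one segment, this
   closes up a circle; otherwise it merges the segment ending at p with the
   segment ending at q. *)
Definition glue (L : finType) (A : presentation L)
    (pq : arrow_end L * arrow_end L) : presentation L :=
  let: (p, q) := pq in
  Presentation (edges A)
    [ffun x => if (x == p) || (x == q) then x
               else if x == seg A p then seg A q
               else if x == seg A q then seg A p
               else seg A x]
    (bare A + (seg A p == q))%N.

Definition glue_all (L : finType) (A : presentation L)
    (s : seq (arrow_end L * arrow_end L)) : presentation L :=
  foldl (@glue L) A s.

Definition forget (L : finType) (A : presentation L) (D : {set L}) :
    presentation L :=
  Presentation (edges A :\: D) (seg A) (bare A).

(* With arrows p1p2 and q1q2 of e:
   p1 = arrow_tail e false, p2 = arrow_head e false,
   q1 = arrow_tail e true,  q2 = arrow_head e true. *)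

Definition contraction (L : finType) (A : presentation L) (e : L) :
    presentation L :=
  forget (glue_all A [:: (arrow_tail e false, arrow_head e true);
                         (arrow_head e false, arrow_tail e true)]) [set e].

(* Deleting an arrow but not its arc joins the segments at its two ends. *)
Definition deletion (L : finType) (A : presentation L) (e : L) :
    presentation L :=
  forget (glue_all A [:: (arrow_tail e false, arrow_head e false);
                         (arrow_tail e true, arrow_head e true)]) [set e].

Definition penrose (L : finType) (A : presentation L) (e : L) :
    presentation L :=
  forget (glue_all A [:: (arrow_tail e false, arrow_tail e true);
                         (arrow_head e false, arrow_head e true)]) [set e].

(* Meaningful when the edge sets are disjoint. *)
Definition disjoint_union (L : finType) (A B : presentation L) :
    presentation L :=
  Presentation (edges A :|: edges B)
    [ffun x : arrow_end L => if x.1.1 \in edges A then seg A x else seg B x]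
    (bare A + bare B)%N.

(* A coupling of f and e is a permutation of bool: it sends the arrow (f, i) to
   the arrow (e, phi i). *)
Definition two_sum (L : finType) (A : presentation L) (f : L)
    (B : presentation L) (e : L) (phi : {perm bool}) : presentation L :=
  forget (glue_all (disjoint_union A B)
            [:: (arrow_tail f false, arrow_tail e (phi false));
                (arrow_head f false, arrow_head e (phi false));
                (arrow_tail f true, arrow_tail e (phi true));
                (arrow_head f true, arrow_head e (phi true))])
         [set f; e].

(* The 2-sums are taken one after another, in the order given by the list s of
   the edges of A. *)
Definition tensor_product (L : finType) (A : presentation L)
    (H : L -> presentation L) (e : L -> L) (phi : L -> {perm bool})
    (s : seq L) : presentation L :=
  foldl (fun B f => two_sum B f (H f) (e f) (phi f)) A s.

(* Q A a b c stands for Q(A; (a, b, c), t).  The triples are functions on all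
   labels; the two clauses below only ever use their values on the edges. *)
Definition transition_polynomial (L : finType) (R : comNzRingType) (t : R)
    (Q : presentation L -> (L -> R) -> (L -> R) -> (L -> R) -> R) : Prop :=
  (forall (A : presentation L) (a b c : L -> R) (e : L),
     arrow_presentation A -> e \in edges A ->
     Q A a b c = a e * Q (contraction A e) a b c
               + b e * Q (deletion A e) a b c
               + c e * Q (penrose A e) a b c) /\
  (forall (A : presentation L) (a b c : L -> R),
     arrow_presentation A -> edges A = set0 ->
     Q A a b c = t ^+ num_vertices A).

(* Existence and uniqueness of the transition polynomial.  [matched X A]: the
   segments of A pair up the arrow ends in X. *)

Definition matched (L : finType) (X : pred (arrow_end L)) (A : presentation L) :=
  involutive (seg A) /\ forall x : arrow_end L, (seg A x != x) = X x.

Lemma glue_matched (L : finType) (X : pred (arrow_end L)) (A : presentation L) p q :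
  matched X A -> X p -> X q -> p != q ->
  matched (fun x => [&& X x, x != p & x != q]) (glue A (p, q)).
Proof.
move=> [invA fixA] Xp Xq npq.
have np : seg A p != p by rewrite fixA.
have nq : seg A q != q by rewrite fixA.
have inj := inv_inj invA.
split=> x; rewrite /= !ffunE.
- case: (eqVneq x p) => [->|xp] /=; first by rewrite eqxx.
  case: (eqVneq x q) => [->|xq] /=; first by rewrite eqxx orbT.
  case: (eqVneq x (seg A p)) => [xsp|xsp].
    have h1 : seg A q != p by apply: contraNneq xq => h; rewrite xsp -h invA.
    by rewrite (negbTE nq) (negbTE h1) /= eqxx xsp (inj_eq inj) eq_sym (negbTE npq).
  case: (eqVneq x (seg A q)) => [xsq|xsq].
    have h1 : seg A p != q by apply: contraNneq xp => h; rewrite xsq -h invA.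
    by rewrite (negbTE np) (negbTE h1) /= eqxx xsq.
  have h1 : seg A x != p by apply: contraNneq xsp => <-; rewrite invA.
  have h2 : seg A x != q by apply: contraNneq xsq => <-; rewrite invA.
  by rewrite (negbTE h1) (negbTE h2) /= !(inj_eq inj) (negbTE xp) (negbTE xq) invA.
- case: (eqVneq x p) => [->|xp] /=; first by rewrite eqxx /= andbF.
  case: (eqVneq x q) => [->|xq] /=; first by rewrite eqxx /= !andbF.
  rewrite -fixA !andbT.
  case: (eqVneq x (seg A p)) => [->|xsp].
    by rewrite invA eq_sym (eq_sym p) np (inj_eq inj).
  case: (eqVneq x (seg A q)) => [->|xsq //].
  by rewrite invA (eq_sym q) nq (inj_eq inj).
Qed.

Local Ltac split_eq :=
  match goal with
  | |- context [?a == ?b] =>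
    lazymatch a with context [if _ then _ else _] => fail | _ => idtac end;
    lazymatch b with context [if _ then _ else _] => fail | _ => idtac end;
    case: (a =P b) => ? /=; try (exfalso; congruence)
  end.

Lemma glueC (L : finType) (X : pred (arrow_end L)) (A : presentation L) p q r s :
  matched X A -> X p -> X q -> X r -> X s -> uniq [:: p; q; r; s] ->
  glue (glue A (p, q)) (r, s) = glue (glue A (r, s)) (p, q).
Proof.
move=> [invA fixA] Xp Xq Xr Xs.
rewrite /= !inE !negb_or !andbT -!andbA => /and5P[/eqP npq /eqP npr /eqP nps /eqP nqr /andP[/eqP nqs /eqP nrs]].
have inj := inv_inj invA.
have np : seg A p <> p by apply/eqP; rewrite fixA.
have nq : seg A q <> q by apply/eqP; rewrite fixA.
have nr : seg A r <> r by apply/eqP; rewrite fixA.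
have ns : seg A s <> s by apply/eqP; rewrite fixA.
move: (invA p) (invA q) (invA r) (invA s) => ip iq ir is_.
have [f Ef] : exists f : arrow_end L -> arrow_end L, f =1 seg A by exists (seg A).
congr Presentation.
- apply/ffunP => x; move: (invA x) => ix; rewrite !ffunE.
  rewrite -!Ef; move: ix ip iq ir is_ np nq nr ns; rewrite -!Ef => *; clear Ef inj invA fixA.
  by repeat (solve [congruence] || split_eq).
- rewrite /= -!addnA; congr addn; rewrite !ffunE.
  rewrite -!Ef; move: ip iq ir is_ np nq nr ns; rewrite -!Ef => *; clear Ef inj invA fixA.
  by repeat (solve [congruence] || split_eq).
Qed.

Definition ends_pairing (L : finType) (j : 'I_3) (e : L) :=
  nth [::] [:: [:: (arrow_tail e false, arrow_head e true); (arrow_head e false, arrow_tail e true)];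
             [:: (arrow_tail e false, arrow_head e false); (arrow_tail e true, arrow_head e true)];
             [:: (arrow_tail e false, arrow_tail e true); (arrow_head e false, arrow_head e true)]] j.

Definition resolve (L : finType) (j : 'I_3) (A : presentation L) (e : L) :=
  forget (glue_all A (ends_pairing j e)) [set e].

Lemma ord3P (P : 'I_3 -> Prop) : P 0 -> P 1 -> P 2%:R -> forall j, P j.
Proof.
move=> h0 h1 h2 [[|[|[|//]]] hj]; [move: h0 | move: h1 | move: h2];
  by congr P; apply/val_inj.
Qed.

Lemma resolve0 (L : finType) (A : presentation L) e : resolve 0 A e = contraction A e.
Proof. by []. Qed.
Lemma resolve1 (L : finType) (A : presentation L) e : resolve 1 A e = deletion A e.
Proof. by []. Qed.
Lemma resolve2 (L : finType) (A : presentation L) e : resolve 2%:R A e = penrose A e.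
Proof. by []. Qed.

Lemma edges_glue_all (L : finType) (A : presentation L) s :
  edges (glue_all A s) = edges A.
Proof. by elim: s A => //= [[p q] s IHs] A; rewrite IHs. Qed.

Local Arguments glue : simpl never.

Definition all_ends (L : finType) (s : seq (arrow_end L * arrow_end L)) :=
  flatten [seq [:: x.1; x.2] | x <- s].

Lemma glue_all_matched (L : finType) (X : pred (arrow_end L)) A s :
  matched X A -> uniq (all_ends s) -> all X (all_ends s) ->
  matched (fun x => X x && (x \notin all_ends s)) (glue_all A s).
Proof.
elim: s X A => [|[p q] s IHs] X A mA /=.
  by case: mA => i f _ _; split=> // x; rewrite f andbT.
rewrite inE negb_or -!andbA => /and4P[npq ps qs us] /and3P[Xp Xq Xs].
have [|i f] := IHs _ _ (glue_matched mA Xp Xq npq) us.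
  apply/allP => x xs; rewrite (allP Xs _ xs) /=.
  by apply/andP; split; [apply: contraNneq ps | apply: contraNneq qs] => <-.
by split=> // x; rewrite f !inE !negb_or !andbA.
Qed.

Lemma glue_consC (L : finType) (X : pred (arrow_end L)) A p q s :
  matched X A -> uniq (p :: q :: all_ends s) -> all X (p :: q :: all_ends s) ->
  glue_all (glue A (p, q)) s = glue (glue_all A s) (p, q).
Proof.
elim: s X A => [//|[r u] s IHs] X A mA U.
have := U; rewrite /= !inE !negb_or -!andbA.
move=> /and5P[npq npr npu ps /and5P[nqr nqu qs nru /and3P[rs us Us]]].
move=> /and5P[Xp Xq Xr Xu Xs].
rewrite (glueC mA) //; last by rewrite /= !inE !negb_or npq npr npu nqr nqu nru.
apply: (IHs _ _ (glue_matched mA Xr Xu nru)).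
  by rewrite /= !inE !negb_or npq ps qs Us.
rewrite /= Xp Xq npr npu nqr nqu /=.
apply/allP => x xs; rewrite (allP Xs _ xs) /=.
by apply/andP; split; [apply: contraNneq rs | apply: contraNneq us] => <-.
Qed.

Lemma glue_allC (L : finType) (X : pred (arrow_end L)) A s t :
  matched X A -> uniq (all_ends s ++ all_ends t) -> all X (all_ends s ++ all_ends t) ->
  glue_all (glue_all A s) t = glue_all (glue_all A t) s.
Proof.
elim: s X A => [//|[p q] s IHs] X A mA.
rewrite [all_ends _]/= -/(all_ends s) !cat_cons => U V.
have := U; have := V; rewrite /= inE negb_or -!andbA.
move=> /and3P[Xp Xq Xs] /and4P[npq ps qs us].
rewrite (IHs _ _ (glue_matched mA Xp Xq npq)) //; last first.
  apply/allP => x xs; rewrite (allP Xs _ xs) /=.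
  by apply/andP; split; [apply: contraNneq ps | apply: contraNneq qs] => <-.
congr (glue_all _ s); apply: (glue_consC mA).
  move: ps qs us; rewrite /= inE !negb_or npq cat_uniq !mem_cat !negb_or.
  by move=> /andP[_ ->] /andP[_ ->] /and3P[].
by move: Xs; rewrite /= Xp Xq all_cat => /andP[].
Qed.

Lemma pairing_ends (L : finType) j (e : L) :
  uniq (all_ends (ends_pairing j e)) /\
  (forall x, (x \in all_ends (ends_pairing j e)) = (x.1.1 == e)).
Proof.
split.
  by move: j; apply: ord3P; rewrite /all_ends /= !inE !xpair_eqE !eqxx.
move=> [[l i] b]; move: j; apply: ord3P; rewrite /all_ends /= !inE !xpair_eqE;
  by case: (l == e); case: i; case: b.
Qed.

Lemma resolve_presentation (L : finType) j (A : presentation L) (e : L) :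
  arrow_presentation A -> e \in edges A -> arrow_presentation (resolve j A e).
Proof.
move=> hA eA; have [U E] := pairing_ends j e.
have [|i f] := glue_all_matched (X := fun x => x.1.1 \in edges A) hA U.
  by apply/allP => x; rewrite E => /eqP ->.
by split=> // x; rewrite [LHS]f E !inE andbC edges_glue_all.
Qed.

Lemma resolveC (L : finType) i j (A : presentation L) (e f : L) :
  arrow_presentation A -> e \in edges A -> f \in edges A -> e != f ->
  resolve i (resolve j A e) f = resolve j (resolve i A f) e.
Proof.
move=> hA eA fA nef; have [U E] := pairing_ends j e; have [V F] := pairing_ends i f.
have glue_forget (B : presentation L) D s : glue_all (forget B D) s = forget (glue_all B s) D.
  by elim: s B => //= [[p q] s IHs] B; rewrite -IHs.
rewrite /resolve !glue_forget (@glue_allC _ (fun x => x.1.1 \in edges A)) //.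
- by rewrite /forget /=; congr Presentation; rewrite setDDl setUC -setDDl.
- rewrite cat_uniq U V andbT; apply/hasPn => x; rewrite F E => /eqP ->.
  by rewrite eq_sym.
- by apply/allP => x; rewrite mem_cat E F => /orP[] /eqP ->.
Qed.

Fixpoint transition_rec (L : finType) (R : comNzRingType) (t : R) n
    (A : presentation L) (a b c : L -> R) : R :=
  if n is n'.+1 then
    if [pick e in edges A] is Some e then
      a e * transition_rec t n' (contraction A e) a b c
      + b e * transition_rec t n' (deletion A e) a b c
      + c e * transition_rec t n' (penrose A e) a b c
    else t ^+ num_vertices A
  else t ^+ num_vertices A.

Lemma transition_polynomial_exists (L : finType) (R : comNzRingType) (t : R) :
  exists Q, @transition_polynomial L R t Q.
Proof.
exists (fun A => transition_rec t #|edges A| A); split; last first.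
  by move=> A a b c hA ->; rewrite cards0.
move=> A a b c e hA eA.
have cardE j B f : f \in edges B -> #|edges (resolve j B f)| = #|edges B|.-1.
  by move=> fB; rewrite /= edges_glue_all (cardsD1 f (edges B)) fB.
rewrite -(resolve0 A) -(resolve1 A) -(resolve2 A) !cardE //.
have [n En] : exists n, n = #|edges A| by exists #|edges A|.
rewrite -En; elim: n A e hA eA En => [|n IHn] A e hA eA En.
  by move: eA; rewrite (cards0_eq (esym En)) inE.
rewrite [LHS]/=; case: pickP => [f fA|/(_ e)]; last by rewrite eA.
case: (eqVneq f e) => [->//|nfe].
have m j g h : g \in edges A -> h \in edges A -> g != h -> h \in edges (resolve j A g).
  by move=> gA hh gh; rewrite /= edges_glue_all !inE eq_sym gh.
have c1 j g : g \in edges A -> n = #|edges (resolve j A g)|.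
  by move=> gA; rewrite cardE // -En.
case: n IHn En c1 => [|n] IHn En c1.
  by move: (m 0 f e fA eA nfe); rewrite (cards0_eq (esym (c1 0 f fA))) inE.
have IH g h j : g \in edges A -> h \in edges A -> g != h ->
    transition_rec t n.+1 (resolve j A g) a b c =
    a h * transition_rec t n (resolve 0 (resolve j A g) h) a b c
    + b h * transition_rec t n (resolve 1 (resolve j A g) h) a b c
    + c h * transition_rec t n (resolve 2%:R (resolve j A g) h) a b c.
  by move=> gA hh gh; apply: IHn; [apply: resolve_presentation | apply: m | apply: c1].
have nef : e != f by rewrite eq_sym.
rewrite -(resolve0 A f) -(resolve1 A f) -(resolve2 A f) !(IH f e) // !(IH e f) //.
clear IH IHn; move: (transition_rec t n) => T.
rewrite !(fun i j => resolveC i j hA eA fA nef).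
move: (@resolve L) => rho.
move: (2%:R : 'I_3) => i2; move: (1 : 'I_3) => i1; move: (0 : 'I_3) => i0.
ring.
Qed.

Lemma transition_polynomial_unique (L : finType) (R : comNzRingType) (t : R) Q Q' :
  @transition_polynomial L R t Q -> @transition_polynomial L R t Q' ->
  forall A a b c, arrow_presentation A -> Q A a b c = Q' A a b c.
Proof.
move=> [rQ bQ] [rQ' bQ'] A a b c.
have [n] := ubnP #|edges A|; elim: n A => // n IHn A cA hA.
case: (set_0Vmem (edges A)) => [A0|[e eA]]; first by rewrite bQ // bQ'.
have IH j : Q (resolve j A e) a b c = Q' (resolve j A e) a b c.
  apply: IHn; last exact: resolve_presentation.
  by move: cA; rewrite /= edges_glue_all (cardsD1 e (edges A)) eA.
by rewrite (rQ _ _ _ _ _ hA eA) (rQ' _ _ _ _ _ hA eA) (IH 0) (IH 1) (IH 2%:R).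
Qed.

Definition triple (R : Type) (x y z : R) : 'cV[R]_3 :=
  \col_(i < 3) nth x [:: x; y; z] i.

Definition transition_mx (R : pzRingType) (t : R) : 'M[R]_3 :=
  \matrix_(i < 3, j < 3) (if i == j then t ^+ 2 else t).

(* The indeterminates are t and a_g, b_g, c_g for g in L. *)
Definition indeterminate (L : finType) : finType := option (L * 'I_3)%type.

Definition ratfun (k : idomainType) (L : finType) : fieldType :=
  {fraction {mpoly k[#|indeterminate L|]}}.

Definition indet (k : idomainType) (L : finType) (v : indeterminate L) :
    ratfun k L :=
  tofrac ('X_(enum_rank v) : {mpoly k[#|indeterminate L|]}).

Definition t_ (k : idomainType) (L : finType) : ratfun k L :=
  indet k (None : indeterminate L).
Definition a_ (k : idomainType) (L : finType) (g : L) : ratfun k L :=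
  indet k (Some (g, 0) : indeterminate L).
Definition b_ (k : idomainType) (L : finType) (g : L) : ratfun k L :=
  indet k (Some (g, 1) : indeterminate L).
Definition c_ (k : idomainType) (L : finType) (g : L) : ratfun k L :=
  indet k (Some (g, 2%:R) : indeterminate L).

(* Main.v *)
(** Resolving every edge of [H] other than [e] in the three possible ways leaves
bare circles together with the edge [e], whose four arrow ends are joined by the
remaining segments in one of three ways.  Forming the 2-sum of [A] with such a
state along [f] and [e] amounts to contracting, deleting or Penrose-contracting
[f] in [A].  Hence Q(A (+) H) is a linear combination of Q(A / f), Q(A \ f) and
Q(A † f) with coefficients that depend only on [H] and [e]; closing the same
states by resolving [e] shows that these coefficients solve the linear system,
whose matrix is invertible over the rational functions. *)

Require Import Defs.
From mathcomp Require Import all_boot all_order all_algebra all_fingroup.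
From mathcomp Require Import ring mpoly.

Set Implicit Arguments.
Unset Strict Implicit.
Unset Printing Implicit Defensive.

Import GRing.Theory.

Local Open Scope ring_scope.

Local Arguments glue : simpl never.

Local Ltac split_eq :=
  match goal with
  | |- context [?a == ?b] =>
    lazymatch a with context [if _ then _ else _] => fail | _ => idtac end;
    lazymatch b with context [if _ then _ else _] => fail | _ => idtac end;
    case: (a =P b) => ? /=; try (exfalso; congruence)
  end.

(** * Gluing calculus: bare circles, order of gluings, gluing through segments *)

Definition add_bare (L : finType) (n : nat) (A : presentation L) :=
  Presentation (edges A) (seg A) (bare A + n)%N.

(** Allows auxiliary circles, added to both sides of an equation, to be cancelled. *)
Lemma add_bare_inj (L : finType) n : injective (@add_bare L n).
Proof. by move=> [? ? ?] [? ? ?] [-> -> /addIn->]. Qed.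

Lemma add_bareD (L : finType) m n (A : presentation L) :
  add_bare m (add_bare n A) = add_bare (n + m) A.
Proof. by rewrite /add_bare /= addnA. Qed.

Lemma glue_all_add_bare (L : finType) n (A : presentation L) s :
  glue_all (add_bare n A) s = add_bare n (glue_all A s).
Proof.
elim: s A => //= [[p q] s IHs] A; rewrite -IHs; congr glue_all.
by rewrite /glue /add_bare /= addnAC.
Qed.

Lemma forgetC (L : finType) (A : presentation L) D D' :
  forget (forget A D) D' = forget (forget A D') D.
Proof. by rewrite /forget /= setDDl setUC -setDDl. Qed.

Lemma glue_all_forget (L : finType) (A : presentation L) D s :
  glue_all (forget A D) s = forget (glue_all A s) D.
Proof. by elim: s A => //= [[p q] s IHs] A; rewrite -IHs. Qed.

Lemma glue_all_cat (L : finType) (A : presentation L) s1 s2 :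
  glue_all A (s1 ++ s2) = glue_all (glue_all A s1) s2.
Proof. exact: foldl_cat. Qed.

Lemma all_ends_perm (L : finType) (s1 s2 : seq (arrow_end L * arrow_end L)) :
  perm_eq s1 s2 -> perm_eq (all_ends s1) (all_ends s2).
Proof. by move=> p12; apply/perm_flatten/perm_map. Qed.

(** Permutations are generated by exchanges of the two leading blocks of a list, and [glue_allC]
    covers one exchange. The predicate [P] also carries the distinctness and matching conditions
    that [glue_allC] demands. *)
Lemma glue_all_perm (L : finType) (X : pred (arrow_end L)) A s1 s2 :
  matched X A -> uniq (all_ends s1) -> all X (all_ends s1) ->
  perm_eq s1 s2 -> glue_all A s1 = glue_all A s2.
Proof.
move=> mA U1 X1 p12.
have all_ends_cat u v : all_ends (u ++ v) = all_ends u ++ all_ends v :> seq (arrow_end L).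
  by rewrite /all_ends map_cat flatten_cat.
pose P s := [/\ uniq (all_ends s), all X (all_ends s) & glue_all A s = glue_all A s1].
suff [] : P s2 by [].
apply: (catCA_perm_ind (P := P) _ p12) => // u v w [U V E].
have pE : perm_eq (all_ends (u ++ v ++ w)) (all_ends (v ++ u ++ w)).
  by rewrite !all_ends_cat perm_catCA.
split; [by rewrite -(perm_uniq pE) | by rewrite -(perm_all X pE) |].
rewrite -E; move: U V; rewrite !all_ends_cat !glue_all_cat catA cat_uniq all_cat.
by move=> /and3P[U _ _] /andP[V _]; rewrite (glue_allC mA U V).
Qed.

(* The segment [q q'] transmits the identification of [p] with [q] and of [p']
   with [q'] to [p] and [p']; on the left it is closed up into one more circle. *)
Lemma glue_through (L : finType) (X : pred (arrow_end L)) (A : presentation L) p p' q q' :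
  matched X A -> X p -> X p' -> X q -> uniq [:: p; p'; q; q'] -> seg A q = q' ->
  glue (glue A (p, p')) (q, q') = add_bare 1 (glue (glue A (p, q)) (p', q')).
Proof.
move=> [invA fixA] Xp Xp' Xq + sq.
rewrite /= !inE !negb_or !andbT -!andbA => /and5P[/eqP npr /eqP npq /eqP nps /eqP nqr /andP[/eqP nqs /eqP nrs]].
have np : seg A p <> p by apply/eqP; rewrite fixA.
have np' : seg A p' <> p' by apply/eqP; rewrite fixA.
have nq : seg A q <> q by apply/eqP; rewrite fixA.
move: (invA p) (invA q) (invA p') (invA q') => ip iq ip' iq'.
(* [f] stands for [seg A] as a plain function, so that [congruence] can settle each pattern of
   coincidences among the ends. *)
have [f Ef] : exists f : arrow_end L -> arrow_end L, f =1 seg A by exists (seg A).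
congr Presentation.
- apply/ffunP => x; move: (invA x) => ix; rewrite !ffunE.
  rewrite -!Ef; move: sq ix ip iq ip' iq' np nq np'; rewrite -!Ef => *; clear Ef invA fixA.
  by repeat (solve [congruence] || split_eq).
- rewrite /= -!addnA; congr addn; rewrite !ffunE.
  rewrite -!Ef; move: sq ip iq ip' iq' np nq np'; rewrite -!Ef => *; clear Ef invA fixA.
  by repeat (solve [congruence] || split_eq).
Qed.

(** A gluing changes [seg] only at [p], [q] and their two partners, and the hypotheses keep [x] away
    from all four. *)
Lemma seg_glue_id (L : finType) (X : pred (arrow_end L)) (A : presentation L) p q x :
  matched X A -> x \notin [:: p; q] -> seg A x \notin [:: p; q] ->
  seg (glue A (p, q)) x = seg A x.
Proof.
move=> [invA _].
have E y : (x == seg A y) = (seg A x == y) by rewrite -{1}(invA x) (inj_eq (inv_inj invA)).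
by rewrite !inE !negb_or /= ffunE !E => /andP[/negbTE-> /negbTE->] /andP[/negbTE-> /negbTE->].
Qed.

(** Each pair of [s] consists of the two ends of one segment, so its identification closes up one
    circle and leaves the segments of the later pairs intact. *)
Lemma bare_glue_all_segments (L : finType) (X : pred (arrow_end L)) (A : presentation L) s :
  matched X A -> uniq (all_ends s) -> all X (all_ends s) ->
  all (fun x => seg A x.1 == x.2) s -> bare (glue_all A s) = (bare A + size s)%N.
Proof.
elim: s X A => [|[p q] s IHs] X A mA; first by rewrite addn0.
rewrite [all_ends _]/= => + + /andP[/eqP sp ss].
rewrite /= inE negb_or -!andbA => /and4P[npq ps qs us] /and3P[Xp Xq Xs].
have {}sp : seg A p = q by [].
rewrite (IHs _ _ (glue_matched mA Xp Xq npq)) //; first by rewrite /= sp eqxx -addnA.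
  apply/allP => x xs; rewrite (allP Xs _ xs) /=.
  by apply/andP; split; [apply: contraNneq ps | apply: contraNneq qs] => <-.
apply/allP => -[x y] xys; have /eqP /= sx := allP ss _ xys.
have xs : x \in all_ends s by apply/flatten_mapP; exists (x, y); rewrite // inE eqxx.
have ys : y \in all_ends s by apply/flatten_mapP; exists (x, y); rewrite // !inE eqxx orbT.
rewrite (seg_glue_id mA) ?sx //= !inE negb_or; apply/andP; split.
- by apply: contraNneq ps => <-.
- by apply: contraNneq qs => <-.
- by apply: contraNneq ps => <-.
- by apply: contraNneq qs => <-.
Qed.

(** [glue_through] is used once per segment. The segment from [u] to [u'] has to survive the gluings
    of the first round, whence [sB] and [sC]. *)
Lemma glue_all_through (L : finType) (X : pred (arrow_end L)) (A : presentation L)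
    p p' q q' r r' u u' :
  matched X A -> all X [:: p; q; p'; q'; r; u; r'; u'] ->
  uniq [:: p; q; p'; q'; r; u; r'; u'] -> seg A q = q' -> seg A u = u' ->
  glue_all A [:: (p, p'); (r, r'); (q, q'); (u, u')] =
  add_bare 2 (glue_all A [:: (p, q); (p', q'); (r, u); (r', u')]).
Proof.
move=> mA XA UA sq su.
have P4 : perm_eq [:: (p, p'); (r, r'); (q, q'); (u, u')]
                  [:: (p, p'); (q, q'); (r, r'); (u, u')].
  by rewrite perm_cons (perm_catCA [:: _] [:: _]).
have PE : perm_eq (all_ends [:: (p, p'); (r, r'); (q, q'); (u, u')])
                  [:: p; q; p'; q'; r; u; r'; u'].
  apply/seq.permP => a /=; ring.
rewrite (glue_all_perm mA _ _ P4); [| by rewrite (perm_uniq PE) | by rewrite (perm_all _ PE)].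
move: XA UA; rewrite /= => /and5P[Xp Xq Xp' Xq' /and5P[Xr Xu Xr' Xu' _]].
rewrite !inE !negb_or -!andbA => UA.
repeat case/andP: UA => ? UA.
have U4 : uniq (all_ends [:: (p, q); (p', q')]).
  by rewrite /= !inE !negb_or; do ?[apply/andP; split].
have X4 : all X (all_ends [:: (p, q); (p', q')]) by rewrite /= Xp Xq Xp' Xq'.
have mC := glue_all_matched mA U4 X4.
have mB : matched (fun x => [&& X x, x != p & x != q]) (glue A (p, q)).
  exact: glue_matched.
have sB : seg (glue A (p, q)) u = u'.
  by rewrite (seg_glue_id mA) // ?su !inE !negb_or; apply/andP; split; rewrite // eq_sym.
have sC : seg (glue (glue A (p, q)) (p', q')) u = u'.
  by rewrite (seg_glue_id mB) // ?sB !inE !negb_or; apply/andP; split; rewrite // eq_sym.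
have U5 : uniq [:: p; p'; q; q'].
  by rewrite /= !inE !negb_or; do ?[apply/andP; split]; rewrite // eq_sym.
have U6 : uniq [:: r; r'; u; u'].
  by rewrite /= !inE !negb_or; do ?[apply/andP; split]; rewrite // eq_sym.
rewrite -[LHS]/(glue_all (glue (glue A (p, p')) (q, q')) [:: (r, r'); (u, u')]).
rewrite (glue_through mA Xp Xp' Xq U5 sq) glue_all_add_bare.
rewrite -[X in add_bare 1 X]/(glue (glue (glue_all A [:: (p, q); (p', q')]) (r, r')) (u, u')).
have Y x : X x -> [/\ x != p, x != q, x != p' & x != q'] ->
    X x && (x \notin all_ends [:: (p, q); (p', q')]).
  by move=> -> [n1 n2 n3 n4]; rewrite /= !inE !negb_or n1 n2 n3 n4.
rewrite (glue_through mC _ _ _ U6 sC) ?add_bareD //.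
- by apply: Y => //; split; rewrite // eq_sym.
- by apply: Y => //; split; rewrite // eq_sym.
- by apply: Y => //; split; rewrite // eq_sym.
Qed.

(** * Disjoint unions, and the three pairings of the ends of an edge *)

Lemma seg_edges (L : finType) (A : presentation L) x :
  arrow_presentation A -> ((seg A x).1.1 \in edges A) = (x.1.1 \in edges A).
Proof. by move=> [iA fA]; rewrite -!fA iA eq_sym. Qed.

Lemma disjoint_union_presentation (L : finType) (A B : presentation L) :
  arrow_presentation A -> arrow_presentation B -> [disjoint edges A & edges B] ->
  arrow_presentation (disjoint_union A B).
Proof.
move=> hA hB dAB; have [iA fA] := hA; have [iB fB] := hB.
split=> x; rewrite /= ?inE !ffunE; last by case: ifP => xA /=; rewrite ?fA ?fB ?xA.
case xA: (x.1.1 \in edges A); first by rewrite seg_edges // xA iA.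
case: ifP => [sA|]; last by rewrite iB.
case xB: (x.1.1 \in edges B); first by rewrite -(seg_edges _ hB) (disjointFr dAB sA) in xB.
by move: xB; rewrite -fB; case: eqP => // xB _; rewrite xB xA in sA.
Qed.

Lemma seg_glue_closed (L : finType) (P : pred (arrow_end L)) (A : presentation L) p q :
  (forall x, P x -> P (seg A x)) -> P p -> P q ->
  forall x, P x -> P (seg (glue A (p, q)) x).
Proof.
by move=> cA Pp Pq x Px; rewrite /= ffunE; do ![case: ifP => _]; rewrite ?cA.
Qed.

(** Closure of [edges A] under [seg A] is assumed in place of [arrow_presentation A]: the former
    survives every gluing, while the latter fails as soon as two ends of edges are glued. *)
Lemma glue_all_disjoint_union_l (L : finType) (A B : presentation L) s :
  (forall x, x.1.1 \in edges A -> (seg A x).1.1 \in edges A) ->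
  all (fun x => x.1.1 \in edges A) (all_ends s) ->
  glue_all (disjoint_union A B) s = disjoint_union (glue_all A s) B.
Proof.
elim: s A => //= [[p q] s IHs] A cA /and3P[Ap Aq As].
rewrite -IHs //; last exact: (seg_glue_closed (P := fun x => x.1.1 \in edges A)).
congr glue_all; rewrite /glue /disjoint_union /= !ffunE Ap; congr Presentation.
- apply/ffunP => x; rewrite !ffunE (Aq : q.1.1 \in _).
  case xA: (x.1.1 \in edges A) => //; have nx y : y.1.1 \in edges A -> (x == y) = false.
    by apply: contraTF => /eqP <-; rewrite xA.
  by rewrite !nx // cA.
- by rewrite addnAC.
Qed.

(** The conditions refer to the complement of [edges A] because [disjoint_union] reads [seg B]
    exactly there. *)
Lemma glue_all_disjoint_union_r (L : finType) (A B : presentation L) s :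
  (forall x, x.1.1 \notin edges A -> (seg B x).1.1 \notin edges A) ->
  all (fun x => x.1.1 \notin edges A) (all_ends s) ->
  glue_all (disjoint_union A B) s = disjoint_union A (glue_all B s).
Proof.
elim: s B => //= [[p q] s IHs] B cB /and3P[Bp Bq Bs].
rewrite -IHs //; last exact: (seg_glue_closed (P := fun x => x.1.1 \notin edges A)).
congr glue_all; rewrite /glue /disjoint_union /= !ffunE (negbTE Bp); congr Presentation.
- apply/ffunP => x; rewrite !ffunE (negbTE (Bq : q.1.1 \notin _)).
  case xA: (x.1.1 \in edges A) => //; have nx y : y.1.1 \notin edges A -> (x == y) = false.
    by apply: contraNF => /eqP <-.
  by rewrite !nx // cB.
- by rewrite addnA.
Qed.

(* [ends_pairing j e] is [coupled_pairing j e false]; starting from the arrow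
   [phi false] instead turns it into the image of [ends_pairing j f] under the
   identifications of a 2-sum, for both couplings [phi]. *)
Definition coupled_pairing (L : finType) (j : 'I_3) (e : L) (i : bool) :=
  nth [::] [:: [:: (arrow_tail e i, arrow_head e (~~ i)); (arrow_head e i, arrow_tail e (~~ i))];
             [:: (arrow_tail e i, arrow_head e i); (arrow_tail e (~~ i), arrow_head e (~~ i))];
             [:: (arrow_tail e i, arrow_tail e (~~ i)); (arrow_head e i, arrow_head e (~~ i))]] j.

Lemma coupled_pairing_ends (L : finType) j (e : L) i :
  uniq (all_ends (coupled_pairing j e i)) /\
  (forall x, (x \in all_ends (coupled_pairing j e i)) = (x.1.1 == e)).
Proof.
split.
  by move: j; apply: ord3P; rewrite /all_ends /= !inE !xpair_eqE !eqxx; case: i.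
move=> [[l a] b]; move: j; apply: ord3P; rewrite /all_ends /= !inE !xpair_eqE;
  by case: (l == e); case: i; case: a; case: b.
Qed.

(** Four points have only three perfect matchings, one for each [j]. Exchanging the two arrows
    preserves each of them, so one [j] serves both values of [i]. *)
Lemma single_edge_pairing (L : finType) (H : presentation L) (e : L) :
  arrow_presentation H -> edges H = [set e] ->
  exists j, forall i, all (fun x => seg H x.1 == x.2) (coupled_pairing j e i).
Proof.
move=> hH E; have [iH fH] := hH.
have sE x : x.1.1 = e -> seg H x \in [:: arrow_tail e false; arrow_head e false;
                                        arrow_tail e true; arrow_head e true].
  move=> xe; have := seg_edges x hH; rewrite E !inE xe eqxx.
  by case: (seg H x) => [[l [] []]] /= /eqP ->; rewrite !eqxx ?orbT.
have sn x : x.1.1 = e -> seg H x <> x.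
  by move=> xe; apply/eqP; rewrite fH E xe inE.
have inj := inv_inj iH.
have := sE (arrow_tail e false) erefl.
have := sE (arrow_head e false) erefl.
have := sE (arrow_tail e true) erefl.
have := sE (arrow_head e true) erefl.
have := sn (arrow_tail e false) erefl.
have := sn (arrow_head e false) erefl.
have := sn (arrow_tail e true) erefl.
have := sn (arrow_head e true) erefl.
have := iH (arrow_tail e false).
have := iH (arrow_head e false).
have := iH (arrow_tail e true).
have := iH (arrow_head e true).
rewrite /coupled_pairing /arrow_tail /arrow_head !inE => i1 i2 i3 i4 n1 n2 n3 n4 E1 E2 E3 E4.
(* The partner of the tail of arrow [false] determines the matching: the head of the same arrow
   gives deletion, the other tail Penrose-contraction, the other head contraction. *)
case/or4P: E4 => /eqP E4; [congruence | exists 1 | exists 2%:R | exists 0];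
case/or4P: E3 => /eqP E3; try congruence;
case/or4P: E2 => /eqP E2; try congruence;
case/or4P: E1 => /eqP E1; try congruence;
by case; rewrite /= ?E1 ?E2 ?E3 ?E4 !eqxx.
Qed.

(** * 2-sums: compatibility with resolving edges, and the one-edge case *)

Definition two_sum_ends (L : finType) (f e : L) (phi : {perm bool}) :=
  [:: (arrow_tail f false, arrow_tail e (phi false));
      (arrow_head f false, arrow_head e (phi false));
      (arrow_tail f true, arrow_tail e (phi true));
      (arrow_head f true, arrow_head e (phi true))].

Lemma perm_bool_true (phi : {perm bool}) : phi true = ~~ phi false.
Proof.
by have := (inj_eq (@perm_inj _ phi) true false); case: (phi true); case: (phi false).
Qed.

Lemma two_sum_endsP (L : finType) (f e : L) (phi : {perm bool}) :
  f != e ->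
  uniq (all_ends (two_sum_ends f e phi)) /\
  (forall x, (x \in all_ends (two_sum_ends f e phi)) = (x.1.1 \in [set f; e])).
Proof.
move=> nfe; rewrite /two_sum_ends perm_bool_true; split.
  rewrite /all_ends /= !inE !xpair_eqE (eq_sym e f) (negbTE nfe).
  by case: (phi false); rewrite !eqxx.
move=> [[l i] b]; rewrite /all_ends /= !inE !xpair_eqE.
by case: (l == f); case: (l == e); case: (phi false); case: i; case: b.
Qed.

Lemma two_sumE (L : finType) (A B : presentation L) f e phi :
  two_sum A f B e phi =
  forget (glue_all (disjoint_union A B) (two_sum_ends f e phi)) [set f; e].
Proof. by []. Qed.

(** Superposing two perfect matchings of four points gives two circles if they coincide and one
    otherwise. This is the source of the entries [t ^+ 2] and [t] of [transition_mx]. *)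
Lemma bare_resolve_single_edge (L : finType) (B : presentation L) e i j :
  arrow_presentation B ->
  all (fun x => seg B x.1 == x.2) (ends_pairing j e) ->
  bare (resolve i B e) = (bare B + (i == j).+1)%N.
Proof.
move=> [iB _]; move: i j; do 2!apply: ord3P; move=> /= /and3P[/eqP s1 /eqP s2 _];
  move: (iB (arrow_tail e false)) (iB (arrow_head e false))
        (iB (arrow_tail e true)) (iB (arrow_head e true));
  rewrite ?s1 ?s2 => r1 r2 r3 r4;
  by rewrite /glue /= !ffunE /= ?s1 ?s2 ?r1 ?r2 ?r3 ?r4 !xpair_eqE !eqxx /= -?addnA.
Qed.

Section TwoSum.
Context (L : finType) (A B : presentation L) (f e : L) (phi : {perm bool}).
Context (hA : arrow_presentation A) (hB : arrow_presentation B).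
Context (dAB : [disjoint edges A & edges B]) (fA : f \in edges A) (eB : e \in edges B).

Let eA : e \notin edges A. Proof. by rewrite (disjointFl dAB). Qed.

Let nfe : f != e. Proof. by apply: contraNneq eA => <-. Qed.

Let seg_disjoint x : x.1.1 \notin edges A -> (seg B x).1.1 \notin edges A.
Proof.
apply: contraNN => sA.
have sB : (seg B x).1.1 \notin edges B by rewrite (disjointFr dAB sA).
suff /eqP <- : seg B x == x by [].
by case: hB => _ /(_ x); rewrite -(seg_edges _ hB) (negbTE sB) => /negbFE.
Qed.

Let all_two_sum_ends :
  all (fun x => x.1.1 \in edges A :|: edges B) (all_ends (two_sum_ends f e phi)).
Proof.
have [_ E] := two_sum_endsP phi nfe.
by apply/allP => x; rewrite E !inE => /orP[] /eqP ->; rewrite ?fA ?eB ?orbT.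
Qed.

Lemma edges_two_sum : edges (two_sum A f B e phi) = (edges A :|: edges B) :\: [set f; e].
Proof. by rewrite -[LHS]/(edges (glue_all _ (two_sum_ends f e phi)) :\: _) edges_glue_all. Qed.

Lemma two_sum_presentation : arrow_presentation (two_sum A f B e phi).
Proof.
have hD := disjoint_union_presentation hA hB dAB.
have [U E] := two_sum_endsP phi nfe.
have [i F] := glue_all_matched hD U all_two_sum_ends.
split=> // x; rewrite [LHS]F E edges_two_sum. by rewrite [RHS]in_setD andbC.
Qed.

(** The ends of [g] are disjoint from those of [f] and [e], so the two families of gluings commute,
    and the gluing at [g] takes place inside [B]. *)
Lemma resolve_two_sum j g :
  g \in edges B -> g != e ->
  resolve j (two_sum A f B e phi) g = two_sum A f (resolve j B g) e phi.
Proof.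
move=> gB nge; have gA : g \notin edges A by rewrite (disjointFl dAB).
have hD := disjoint_union_presentation hA hB dAB.
have [U E] := two_sum_endsP phi nfe; have [V F] := pairing_ends j g.
rewrite !two_sumE /resolve glue_all_forget (glue_allC hD).
- rewrite glue_all_disjoint_union_r; first last.
  + by apply/allP => x; rewrite F => /eqP ->.
  + exact: seg_disjoint.
  set C := glue_all B _.
  have -> : disjoint_union A (forget C [set g]) = forget (disjoint_union A C) [set g].
    rewrite /disjoint_union /forget /=; congr Presentation.
    by rewrite setDUl; congr setU; apply/esym/setDidPl; rewrite disjoint_sym disjoints1.
  by rewrite glue_all_forget forgetC.
- rewrite cat_uniq U V andbT /=; apply/hasPn => x; rewrite F E => /eqP ->.
  rewrite !inE negb_or nge andbT.
  by apply: contraNneq gA => ->.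
- by apply/allP => x; rewrite mem_cat => /orP[/(allP all_two_sum_ends)//|]; rewrite F !inE => /eqP->; rewrite gB orbT.
Qed.

(** Common form of the three cases of [two_sum_single_edge]: [(p, p')] and [(r, r')] pair the ends
    of [f], while [(q, q')] and [(u, u')] are the segments of [B] at [e]. *)
Lemma two_sum_through p p' q q' r r' u u' :
  perm_eq [:: (p, q); (p', q'); (r, u); (r', u')] (two_sum_ends f e phi) ->
  q.1.1 = e -> u.1.1 = e -> seg B q = q' -> seg B u = u' ->
  forget (glue_all (disjoint_union A B) [:: (p, p'); (r, r'); (q, q'); (u, u')]) [set f; e]
  = add_bare 2 (two_sum A f B e phi).
Proof.
move=> P qe ue sq su; have PE := all_ends_perm P.
have hD := disjoint_union_presentation hA hB dAB.
have [U E] := two_sum_endsP phi nfe.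
have X8 := all_two_sum_ends; rewrite -(perm_all _ PE) in X8.
have U8 := U; rewrite -(perm_uniq PE) in U8.
rewrite (glue_all_through hD X8 U8).
- by rewrite (glue_all_perm hD U8 X8 P).
- by rewrite ffunE qe (negbTE eA).
- by rewrite ffunE ue (negbTE eA).
Qed.

(** The four ends of [f] are glued by the pairing [j], and those of [e] along the segments of [B].
    Computed through the 2-sum this gives two extra circles; computed separately in [A] and [B] it
    resolves [f] and also closes two circles in [B]. *)
Lemma two_sum_single_edge j :
  edges B = [set e] ->
  (forall i, all (fun x => seg B x.1 == x.2) (coupled_pairing j e i)) ->
  two_sum A f B e phi = add_bare (bare B) (resolve j A f).
Proof.
move=> EB sj.
have [U E] := coupled_pairing_ends j e (phi false).
have [V F] := pairing_ends j f.
have XB : all (fun x => x.1.1 \in edges B) (all_ends (coupled_pairing j e (phi false))).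
  by apply/allP => x; rewrite E => /eqP ->.
apply: (@add_bare_inj _ 2).
have <- :
  forget (glue_all (disjoint_union A B)
           (ends_pairing j f ++ coupled_pairing j e (phi false))) [set f; e] =
  add_bare 2 (two_sum A f B e phi).
  move: (perm_bool_true phi) => phiT.
  have := sj (phi false); move: (j) (two_sum_through) => {sj V F U E XB}; apply: ord3P => T /=.
  - move=> /and3P[/eqP s1 /eqP s2 _]; apply: T => //; apply/seq.permP => a /=; rewrite phiT; ring.
  - move=> /and3P[/eqP s1 /eqP s2 _]; apply: T => //; apply/seq.permP => a /=; rewrite phiT; ring.
  - move=> /and3P[/eqP s1 /eqP s2 _]; apply: T => //; apply/seq.permP => a /=; rewrite phiT; ring.
rewrite glue_all_cat glue_all_disjoint_union_l; last first.
- by apply/allP => x; rewrite F => /eqP ->.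
- by move=> x; rewrite seg_edges.
rewrite glue_all_disjoint_union_r; last first.
- rewrite edges_glue_all; apply: sub_all XB => x xB; by rewrite (disjointFl dAB).
- rewrite edges_glue_all; exact: seg_disjoint.
have [_ F2] := glue_all_matched hB U XB.
have bB := bare_glue_all_segments hB U XB (sj _).
set C := glue_all B _ in F2 bB *.
have sC x : seg C x = x.
  by apply/eqP; rewrite -[_ == _]negbK F2 E EB inE andbN.
have XA : all (fun x => x.1.1 \in edges A) (all_ends (ends_pairing j f)).
  by apply/allP => x; rewrite F => /eqP ->.
have [_ FA] := glue_all_matched hA V XA.
rewrite add_bareD /add_bare /resolve /forget /disjoint_union; congr Presentation => /=.
- rewrite !edges_glue_all EB; apply/setP => x; rewrite !inE.
  by case: (eqVneq x e) => [->|]; rewrite ?(negbTE eA) ?andbF ?orbF ?orbT.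
- apply/ffunP => x; rewrite ffunE edges_glue_all sC.
  case: ifP => // xA; apply/esym/eqP.
  by rewrite -[_ == _]negbK FA xA.
- rewrite bB !addnA; congr addn.
  (* Each of the three pairings consists of two pairs, which accounts for the two circles. *)
  by move: (j); apply: ord3P.
Qed.

End TwoSum.

(** * Expansion of the transition polynomial of 2-sums and tensor products *)

Section TransitionPolynomial.
Context (L : finType) (R : comNzRingType) (t : R).
Context (Q : presentation L -> (L -> R) -> (L -> R) -> (L -> R) -> R).
Context (hQ : transition_polynomial t Q).

Lemma card_edges_resolve j (A : presentation L) e n :
  e \in edges A -> (#|edges A| < n.+1)%N -> (#|edges (resolve j A e)| < n)%N.
Proof. by move=> eA; rewrite /= edges_glue_all (cardsD1 e (edges A)) eA. Qed.

Lemma transition_rule (A : presentation L) a b c e :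
  arrow_presentation A -> e \in edges A ->
  Q A a b c = \sum_(j < 3) nth a [:: a; b; c] j e * Q (resolve j A e) a b c.
Proof. by move=> hA eA; rewrite (hQ.1 _ _ _ _ _ hA eA) !big_ord_recl big_ord0 addr0 addrA. Qed.

Lemma transition_edgeless (A : presentation L) a b c :
  arrow_presentation A -> edges A = set0 -> Q A a b c = t ^+ bare A.
Proof.
move=> hA A0; rewrite (hQ.2 _ _ _ _ hA A0); congr (_ ^+ _).
rewrite /num_vertices [n_comp _ _]eq_card0 ?addn0 // => x.
by rewrite !inE A0 inE andbF.
Qed.

(** The recursion only meets weights of edges still present. This is what permits changing the
    triples elsewhere in the tensor product induction. *)
Lemma eq_transition (A : presentation L) a b c a' b' c' :
  arrow_presentation A -> {in edges A, a =1 a'} -> {in edges A, b =1 b'} ->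
  {in edges A, c =1 c'} -> Q A a b c = Q A a' b' c'.
Proof.
have [n] := ubnP #|edges A|; elim: n A => // n IHn A cA hA Ea Eb Ec.
case: (set_0Vmem (edges A)) => [A0|[e eA]]; first by rewrite !transition_edgeless.
rewrite !(transition_rule _ _ _ hA eA); apply: eq_bigr => j _; congr (_ * _).
  by move: j; apply: ord3P; rewrite /= ?Ea ?Eb ?Ec.
have sub x : x \in edges (resolve j A e) -> x \in edges A.
  by rewrite /= edges_glue_all inE => /andP[].
apply: IHn; [exact: card_edges_resolve | exact: resolve_presentation | | |];
  by move=> x /sub; auto.
Qed.

Lemma transition_add_bare n (A : presentation L) a b c :
  arrow_presentation A -> Q (add_bare n A) a b c = t ^+ n * Q A a b c.
Proof.
have [m] := ubnP #|edges A|; elim: m A => // m IHm A cA hA.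
have hA' : arrow_presentation (add_bare n A) := hA.
case: (set_0Vmem (edges A)) => [A0|[e eA]].
  by rewrite !transition_edgeless //= exprD mulrC.
rewrite (transition_rule _ _ _ hA eA) (transition_rule _ _ _ hA' eA) big_distrr.
apply: eq_bigr => j _ /=; rewrite mulrCA; congr (_ * _).
rewrite -IHm; [| exact: card_edges_resolve | exact: resolve_presentation].
by rewrite /resolve glue_all_add_bare.
Qed.

(** [x j] is the total weight of the states of [B] away from [e] whose segments join the ends of [e]
    by the pairing [j]. As [x] is chosen before [A], the same coefficients serve the linear system
    and every 2-sum. The induction resolves an edge [g] other than [e], which commutes with
    resolving [e] and with the 2-sum. *)
Lemma transition_two_sum (B : presentation L) e a b c :
  arrow_presentation B -> e \in edges B ->
  exists x : 'I_3 -> R,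
    (forall i, Q (resolve i B e) a b c = \sum_j transition_mx t i j * x j) /\
    forall (A : presentation L) f phi, arrow_presentation A ->
      [disjoint edges A & edges B] -> f \in edges A ->
      Q (two_sum A f B e phi) a b c = \sum_j x j * Q (resolve j A f) a b c.
Proof.
have [n] := ubnP #|edges B|; elim: n B => // n IHn B cB hB eB.
case: (set_0Vmem (edges B :\ e)) => [B0|[g]].
  have EB : edges B = [set e].
    by rewrite -(setD1K eB) B0 setU0.
  have [j sj] := single_edge_pairing hB EB.
  (* With [e] as the only edge there is a single state, of pairing [j], with a factor [t] for each
     bare circle. *)
  exists (fun l => t ^+ bare B *+ (l == j)); split=> [i|A f phi hA dAB fA].
    rewrite transition_edgeless; first last.
    - by rewrite /= edges_glue_all EB setDv.
    - exact: resolve_presentation.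
    rewrite (bare_resolve_single_edge i hB (sj false)) (bigD1 j) //= eqxx big1 => [|l nlj].
      by rewrite addr0 mxE exprD mulrC; case: eqP.
    by rewrite (negbTE nlj) mulr0.
  rewrite (two_sum_single_edge _ _ _ _ _ _ _ sj) // transition_add_bare; last first.
    exact: resolve_presentation.
  rewrite (bigD1 j) //= eqxx big1 ?addr0 // => l nlj.
  by rewrite (negbTE nlj) mul0r.
rewrite !inE => /andP[nge gB].
have hBj j := resolve_presentation j hB gB.
have eBj j : e \in edges (resolve j B g).
  by rewrite /= edges_glue_all !inE eq_sym nge.
have /fin_all_exists [x hx] j := IHn _ (card_edges_resolve j gB cB) (hBj j) (eBj j).
pose w (j : 'I_3) := nth a [:: a; b; c] j g.
(* [l] runs over the resolutions of [g], with weights [w l]; [x l] are the coefficients of the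
   presentation so obtained. *)
exists (fun j => \sum_l w l * x l j); split.
  move=> i; rewrite (@transition_rule _ a b c g); first last.
  - by rewrite /= edges_glue_all !inE nge.
  - exact: resolve_presentation.
  under [RHS]eq_bigr do rewrite big_distrr /=.
  rewrite exchange_big; apply: eq_bigr => l _ /=.
  rewrite resolveC // 1?eq_sym // (hx l).1 big_distrr; apply: eq_bigr => j _ /=.
  by rewrite mulrCA.
move=> A f phi hA dAB fA.
rewrite (@transition_rule _ a b c g); first last.
- by rewrite edges_two_sum // !inE gB orbT andbT negb_or nge andbT; apply: contraTneq gB => ->; rewrite (disjointFr dAB).
- exact: two_sum_presentation.
under [RHS]eq_bigr do rewrite big_distrl /=.
rewrite exchange_big; apply: eq_bigr => l _ /=.
rewrite resolve_two_sum // (hx l).2 //; last first.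
  by rewrite /= edges_glue_all; apply: disjointWr dAB; exact: subsetDl.
by rewrite big_distrr; apply: eq_bigr => j _ /=; rewrite mulrA.
Qed.

Context (transition_mx_inj : injective (mulmx (transition_mx t) : 'cV_3 -> 'cV_3)).

(** The coefficients given by [transition_two_sum] solve the same linear system, so injectivity of
    the matrix identifies them with [x], [y], [z]. *)
Lemma transition_two_sum_solution (A B : presentation L) f e phi a b c x y z :
  arrow_presentation A -> arrow_presentation B -> [disjoint edges A & edges B] ->
  f \in edges A -> e \in edges B ->
  transition_mx t *m triple x y z =
    triple (Q (contraction B e) a b c) (Q (deletion B e) a b c) (Q (penrose B e) a b c) ->
  Q (two_sum A f B e phi) a b c =
    \sum_(j < 3) nth x [:: x; y; z] j * Q (resolve j A f) a b c.
Proof.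
move=> hA hB dAB fA eB sys.
have [u [sysu ->//]] := transition_two_sum a b c hB eB.
suff /matrixP E : triple x y z = \col_j u j.
  by apply: eq_bigr => j _; have := E j 0; rewrite !mxE => ->.
apply: transition_mx_inj; rewrite sys; apply/matrixP => i k; rewrite !mxE.
under eq_bigr do rewrite [(\col_j u j) _ _]mxE.
by rewrite -sysu; move: i; apply: ord3P.
Qed.

(** Intermediate weights of the induction: edges still to be replaced, listed in [s], carry the
    solutions of their systems, all others the original weights. *)
Definition override (s : seq L) (x a : L -> R) (g : L) := if g \in s then x g else a g.

(** [s] may list only some edges of [A], because after the first 2-sum the presentation also has the
    edges of [H f], which are not to be replaced. *)
Lemma transition_tensor_product (A : presentation L) H e phi s x y z a b c :
  arrow_presentation A -> uniq s -> {subset s <= edges A} ->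
  {in s, forall f, [/\ arrow_presentation (H f), e f \in edges (H f),
     [disjoint edges A & edges (H f)] &
     transition_mx t *m triple (x f) (y f) (z f) =
       triple (Q (contraction (H f) (e f)) a b c) (Q (deletion (H f) (e f)) a b c)
              (Q (penrose (H f) (e f)) a b c)]} ->
  {in s &, forall f g, f != g -> [disjoint edges (H f) & edges (H g)]} ->
  Q (tensor_product A H e phi s) a b c =
  Q A (override s x a) (override s y b) (override s z c).
Proof.
elim: s A => [//|f s IHs] A hA /= /andP[fs Us] sA hs dH.
have fA : f \in edges A by apply: sA; rewrite mem_head.
have sub g : g \in s -> g \in f :: s by rewrite inE orbC => ->.
have [hB eB dAB sys] := hs f (mem_head f s).
rewrite IHs //; first last.
- by move=> g h /sub gs /sub hs'; apply: dH.
- move=> g gs; have [hg eg dg sysg] := hs g (sub g gs); split=> //.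
  have nfg : f != g by apply: contraNneq fs => ->.
  rewrite edges_two_sum //; apply: (disjointWl (subsetDl _ _)).
  by rewrite -setI_eq0 setIUl setU_eq0 !setI_eq0 dg dH // ?mem_head ?sub.
- move=> g gs; have gA := sA g (sub g gs).
  rewrite edges_two_sum // !inE gA andbT negb_or.
  apply/andP; split; first by apply: contraNneq fs => <-.
  by apply: contraTneq gA => ->; rewrite (disjointFl dAB).
- exact: two_sum_presentation.
(* The system for [H f] is stated with the original weights; they agree with the overridden ones
   there, since [s] lies in [edges A], disjoint from [edges (H f)]. *)
have EH j v w : {in edges (resolve j (H f) (e f)), override s v w =1 w}.
  move=> g; rewrite /= edges_glue_all inE => /andP[_ gH]; rewrite /override.
  by case: ifP => // /sub/sA; rewrite (disjointFl dAB).
have QH j : Q (resolve j (H f) (e f)) (override s x a) (override s y b) (override s z c) =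
    Q (resolve j (H f) (e f)) a b c.
  by apply: eq_transition; [exact: resolve_presentation | exact: EH ..].
rewrite (transition_two_sum_solution (phi f) hA hB dAB fA eB (x := x f) (y := y f) (z := z f)).
  rewrite (transition_rule _ _ _ hA fA); apply: eq_bigr => j _; congr (_ * _).
    by move: j; apply: ord3P; rewrite /= /override mem_head.
  (* Once [f] is resolved it is no longer an edge, so adding it to the override list changes
     nothing. *)
  have EA v w : {in edges (resolve j A f), override s v w =1 override (f :: s) v w}.
    by move=> g; rewrite /= edges_glue_all !inE /override inE => /andP[/negbTE->].
  by apply: eq_transition; [exact: resolve_presentation | exact: EA ..].
by rewrite sys -(QH 0) -(QH 1) -(QH 2%:R).
Qed.

End TransitionPolynomial.

(** * Invertibility over the rational functions, and the conclusion *)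

Lemma transition_mx_unit (F : fieldType) (t : F) :
  t != 0 -> t - 1 != 0 -> t + 2%:R != 0 -> transition_mx t \in unitmx.
Proof.
move=> t0 t1 t2.
(* With [J] the all-ones matrix, the matrix is [t] times [(t - 1) I + J]; as [J] squared is [3 J],
   the product with [N = (t + 2) I - J] is scalar. *)
pose N : 'M[F]_3 := \matrix_(i, j) ((i == j)%:R * (t + 2%:R) - 1).
have E : transition_mx t *m N = (t * (t - 1) * (t + 2%:R))%:M.
  apply/matrixP => i j; rewrite !mxE !big_ord_recl big_ord0 !mxE.
  by move: i j; do 2!apply: ord3P; rewrite /= ?mulr1n ?mulr0n; ring.
suff /mulmx1_unit[] : transition_mx t *m ((t * (t - 1) * (t + 2%:R))^-1 *: N) = 1%:M by [].
by rewrite -scalemxAr E scale_scalar_mx mulVf // !mulf_neq0.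
Qed.

(** The coefficient of the indeterminate [t] is 1, in any characteristic. The constants 0, -1 and 2
    give the three factors to be inverted. *)
Lemma t_addC_neq0 (k : idomainType) (L : finType) (x : k) :
  t_ k L + tofrac (x%:MP_[#|indeterminate L|]) != 0.
Proof.
rewrite /t_ /indet -tofracD tofrac_eq0; set v := enum_rank _.
apply/eqP => /(congr1 (mcoeff U_(v))); rewrite mcoeffD mcoeffX eqxx mcoeffC mcoeff0.
by rewrite mnm1_eq0 mulr0 addr0 => /eqP; rewrite oner_eq0.
Qed.

Theorem theorem4p5 (k : idomainType) (L : finType)
    (Q : presentation L -> (L -> ratfun k L) -> (L -> ratfun k L) ->
         (L -> ratfun k L) -> ratfun k L)
    (hQ : transition_polynomial (t_ k L) Q)
    (A : presentation L) (hA : arrow_presentation A)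
    (H : L -> presentation L)
    (hH : forall f : L, f \in edges A -> arrow_presentation (H f))
    (disjAH : forall f : L, f \in edges A -> [disjoint edges A & edges (H f)])
    (disjHH : forall f g : L, f \in edges A -> g \in edges A -> f != g ->
       [disjoint edges (H f) & edges (H g)])
    (e : L -> L) (he : forall f : L, f \in edges A -> e f \in edges (H f))
    (phi : L -> {perm bool})
    (s : seq L) (hs : perm_eq s (enum (edges A))) :
  let a := a_ k (L:=L) in
  let b := b_ k (L:=L) in
  let c := c_ k (L:=L) in
  let rhs (f : L) : 'cV[ratfun k L]_3 :=
    triple (Q (contraction (H f) (e f)) a b c)
           (Q (deletion (H f) (e f)) a b c)
           (Q (penrose (H f) (e f)) a b c) in
  (forall f : L, f \in edges A ->
     exists! x : 'cV[ratfun k L]_3, transition_mx (t_ k L) *m x = rhs f) /\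
  (forall phi_par phi_eq phi_cross : L -> ratfun k L,
     (forall f : L, f \in edges A ->
        transition_mx (t_ k L) *m triple (phi_par f) (phi_eq f) (phi_cross f)
        = rhs f) ->
     Q (tensor_product A H e phi s) a b c = Q A phi_par phi_eq phi_cross).
Proof.
move=> a b c rhs.
have U : transition_mx (t_ k L) \in unitmx.
  apply: transition_mx_unit.
  - by have := t_addC_neq0 L (0 : k); rewrite mpolyC0 tofrac0 addr0.
  - by have := t_addC_neq0 L (-1 : k); rewrite mpolyCN mpolyC1 tofracN tofrac1.
  - by have := t_addC_neq0 L (2%:R : k); rewrite rmorph_nat tofracMn tofrac1.
split=> [f fA|x y z sys].
  exists (invmx (transition_mx (t_ k L)) *m rhs f); split; first by rewrite mulKVmx.
  by move=> u <-; rewrite mulKmx.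
have sE f : (f \in s) = (f \in edges A) by rewrite (perm_mem hs) mem_enum.
rewrite (transition_tensor_product hQ (can_inj (mulKmx U)) phi (x := x) (y := y) (z := z)) //.
(* [s] enumerates all of [edges A], so on these edges the override is total. *)
- by apply: (eq_transition hQ) => // f fA; rewrite /override sE fA.
- by rewrite (perm_uniq hs) enum_uniq.
- by move=> f; rewrite sE.
- by move=> f; rewrite sE => fA; split; auto.
- by move=> f g; rewrite !sE; auto.
Qed.
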